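(* Let $X$ be a nonempty set and let $\Phi$ be a mapping with the domain $X^{2}$. Then the following conditions are equivalent: (i) There is a strongly rigid pseudometric $d \colon X^{2} \to \mathbb{R}$ such that $P_{\Phi^{-1}} = P_{d^{-1}}$. (ii) $\Phi$ is combinatorially similar to a strongly rigid pseudometric. (iii) There is a partition $P$ of $X$ such that the partitions $P \otimes P_{S}^{1}$ and $P_{\Phi^{-1}}$ of $X^2$ are equal, $P \otimes P_{S}^{1} = P_{\Phi^{-1}}$, and the inequality $|P| \leqslant \mathfrak{c}$ holds.
   Context: $\mathfrak{c}$ is the cardinality of the continuum. A mapping $\Phi$ with domain $X^2$ may take values in an arbitrary set; $\Phi(X^2)$ is its image, and $P_{\Phi^{-1}}:=\{\Phi^{-1}(a):a\in\Phi(X^2)\}$ is the partition of $X^2$ into the fibers of $\Phi$ (similarly $P_{d^{-1}}$ for $d$). A pseudometric on a set $Y$ is a function $d\colon Y^2\to\mathbb{R}$ that is nonnegative, symmetric, satisfies $d(x,x)=0$ for all $x\in Y$, and satisfies the triangle inequality. It is strongly rigid if, for all $x,y,u,v\in Y$, $d(x,y)=d(u,v)\neq 0$ implies that ($d(x,u)=0$ and $d(y,v)=0$) or ($d(x,v)=0$ and $d(y,u)=0$). A mapping $\Phi$ with domain $X^2$ is combinatorially similar to a mapping $\Psi$ with domain $Y^2$ if there are bijections $f\colon\Phi(X^2)\to\Psi(Y^2)$ and $g\colon Y\to X$ such that $\Psi(x,y)=f(\Phi(g(x),g(y)))$ for all $x,y\in Y$. In (ii) the pseudometric is on some set $Y$.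 A partition of a nonempty set is a set of nonempty, pairwise disjoint subsets (blocks) whose union is the whole set. For a partition $P=\{X_j:j\in J\}$ of $X$ (with $X_{j_1}\ne X_{j_2}$ for $j_1\neq j_2$), $P\otimes P_S^1$ is the partition of $X^2$ whose blocks are exactly the set $\bigcup_{j\in J}X_j^2$ and the sets $(X_{j_1}\times X_{j_2})\cup(X_{j_2}\times X_{j_1})$ with distinct $j_1,j_2\in J$. *)

(* Defs.v *)
From HB Require Import structures.
From mathcomp Require Import all_boot all_order all_algebra.
From mathcomp Require Import boolp classical_sets functions cardinality reals.

Set Implicit Arguments.
Unset Strict Implicit.
Unset Printing Implicit Defensive.

Import Order.TTheory GRing.Theory Num.Theory.

Local Open Scope classical_set_scope.
Local Open Scope ring_scope.

Definition pseudometric (R : realType) (Y : Type) (d : Y * Y -> R) : Prop :=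
  [/\ forall x y, 0 <= d (x, y),
      forall x y, d (x, y) = d (y, x),
      forall x, d (x, x) = 0 &
      forall x y z, d (x, z) <= d (x, y) + d (y, z)].

Definition strongly_rigid (R : realType) (Y : Type) (d : Y * Y -> R) : Prop :=
  forall x y u v, d (x, y) = d (u, v) -> d (u, v) <> 0 ->
    (d (x, u) = 0 /\ d (y, v) = 0) \/ (d (x, v) = 0 /\ d (y, u) = 0).

Definition strongly_rigid_pseudometric (R : realType) (Y : Type)
    (d : Y * Y -> R) : Prop :=
  pseudometric d /\ strongly_rigid d.

Definition fiber_partition (T Z : Type) (F : T -> Z) : set (set T) :=
  [set F @^-1` [set a] | a in range F].

(* The bijection between the images is a total function [f], of which only
   the restriction to [range Phi] matters. Such an extension always exists
   when the carriers are nonempty. *)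
Definition combinatorially_similar (X Y Z W : Type)
    (Phi : X * X -> Z) (Psi : Y * Y -> W) : Prop :=
  exists (f : Z -> W) (g : Y -> X),
    [/\ set_bij (range Phi) (range Psi) f,
        bijective g &
        forall x y, Psi (x, y) = f (Phi (g x, g y))].

(* $P \otimes P_S^1$; the index set of the partition is the set of blocks. *)
Definition tensor_PS1 (X : Type) (P : set (set X)) : set (set (X * X)) :=
  [set \bigcup_(A in P) (A `*` A)] `|`
  [set C | exists A B,
     [/\ P A, P B, A <> B & C = (A `*` B) `|` (B `*` A)]].

(* Main.v *)
Require Import Defs.
From HB Require Import structures.
From mathcomp Require Import all_boot all_order all_algebra.
From mathcomp Require Import lra.
From mathcomp Require Import boolp classical_sets functions cardinality reals.

(** The fibers of a strongly rigid pseudometric [d] are exactly the blocks of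
    [P (x) P_S^1], where [P] is the partition into classes of the relation
    [d (x, y) = 0]; and [d (x0, _)] separates these classes, so there are at
    most continuum many of them. Conversely, if the blocks are labelled by reals,
    choose an injection from unordered pairs of reals to the interval from 2 to
    7/2 and use its values as the distances between distinct blocks: any symmetric
    function with values between [a] and [2 a] off the diagonal satisfies the
    triangle inequality, and injectivity gives strong rigidity. *)

Import Order.TTheory GRing.Theory Num.Theory.

Local Open Scope ring_scope.
Local Open Scope classical_set_scope.
Local Open Scope card_scope.

(** * Binary sequences coded injectively by reals *)

Definition ternary_psum (R : realType) (b : nat -> bool) (n : nat) : R :=
  \sum_(i < n) (b i)%:R * 3^-1 ^+ i.

Definition ternary_sum (R : realType) (b : nat -> bool) : R :=
  sup (range (ternary_psum R b)).

Lemma ternary_psumS (R : realType) b n :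
  ternary_psum R b n.+1 = ternary_psum R b n + (b n)%:R * 3^-1 ^+ n.
Proof. by rewrite /ternary_psum big_ord_recr. Qed.

(** The upper bound carries the exact geometric tail, as 3/2 * (3^-m - 3^-(m+n)) is the sum of 3^-i
    for m <= i < m + n; this form lets the induction on [n] close. *)
Lemma ternary_psumD (R : realType) b m n :
  ternary_psum R b m <= ternary_psum R b (m + n) <=
    ternary_psum R b m + 3 / 2 * 3^-1 ^+ m - 3 / 2 * 3^-1 ^+ (m + n).
Proof.
elim: n => [|n /andP[IHl IHr]]; first by rewrite addn0; lra.
rewrite addnS ternary_psumS.
have : 0 < 3^-1 ^+ (m + n) :> R by rewrite exprn_gt0// invr_gt0 ltr0n.
rewrite [X in _ -> is_true (_ && (_ <= _ - _ * X))]exprSr.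
by case: (b (m + n)%N) => /=; rewrite ?(mul1r, mul0r); lra.
Qed.

Lemma ternary_psum_le (R : realType) b m n :
  ternary_psum R b n <= ternary_psum R b m + 3 / 2 * 3^-1 ^+ m.
Proof.
have e_ge0 k : 0 <= 3^-1 ^+ k :> R by rewrite exprn_ge0// invr_ge0 ler0n.
have [mn|/ltnW nm] := leqP m n.
  have := ternary_psumD R b m (n - m); rewrite subnKC//.
  by have := e_ge0 n; lra.
have := ternary_psumD R b n (m - n); rewrite subnKC//.
by have := e_ge0 m; lra.
Qed.

Lemma ternary_psum_le_sum (R : realType) b m :
  ternary_psum R b m <= ternary_sum R b.
Proof.
apply: ub_le_sup; last by exists m.
exists (ternary_psum R b 0 + 3 / 2 * 3^-1 ^+ 0) => _ [n _ <-].
exact: ternary_psum_le.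
Qed.

Lemma ternary_sum_le (R : realType) b m :
  ternary_sum R b <= ternary_psum R b m + 3 / 2 * 3^-1 ^+ m.
Proof.
apply: ge_sup; first by exists (ternary_psum R b 0); exists 0%N.
by move=> _ [n _ <-]; apply: ternary_psum_le.
Qed.

Lemma ternary_sum_itv (R : realType) b : 0 <= ternary_sum R b <= 3 / 2.
Proof.
have := ternary_psum_le_sum R b 0; have := ternary_sum_le R b 0.
by rewrite /ternary_psum big_ord0 expr0; lra.
Qed.

(** At the first difference [c] gains 3^-n, while all later terms of [b] add at most 3/2 * 3^-(n+1),
    half of that gain. *)
Lemma ternary_sum_lt (R : realType) (b c : nat -> bool) n :
    (forall i, (i < n)%N -> b i = c i) -> b n = false -> c n = true ->
  ternary_sum R b < ternary_sum R c.
Proof.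
move=> bc bn cn.
have bcn : ternary_psum R b n = ternary_psum R c n.
  by apply: eq_bigr => i _; rewrite bc.
have := ternary_sum_le R b n.+1; have := ternary_psum_le_sum R c n.+1.
rewrite !ternary_psumS bn cn bcn exprSr mul0r mul1r.
have : 0 < 3^-1 ^+ n :> R by rewrite exprn_gt0// invr_gt0 ltr0n.
by lra.
Qed.

Lemma ternary_sum_inj (R : realType) (b c : nat -> bool) :
  ternary_sum R b = ternary_sum R c -> b =1 c.
Proof.
move=> bc i; apply/eqP/negPn/negP => bci.
have [n bcn minn] := ex_minnP (ex_intro (fun k => b k != c k) i bci).
have below k : (k < n)%N -> b k = c k.
  move=> kn; apply/eqP/negPn/negP => /minn; by rewrite leqNgt kn.
move: bcn; case bn: (b n); case cn: (c n) => // _.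
  have := @ternary_sum_lt R c b n (fun k kn => esym (below k kn)) cn bn.
  by rewrite bc ltxx.
by have := @ternary_sum_lt R b c n below bn cn; rewrite bc ltxx.
Qed.

(** * Unordered pairs of reals coded by reals *)

Lemma eq_rat_cut (R : realType) (x y : R) :
  (forall q : rat, (ratr q < x) = (ratr q < y)) -> x = y.
Proof.
move=> xy; apply/eqP; rewrite eq_le; apply/andP; split; rewrite leNgt; apply/negP.
  move=> /rat_in_itvoo[q]; rewrite in_itv/= => /andP[yq qx].
  by move: qx; rewrite xy ltNge (ltW yq).
move=> /rat_in_itvoo[q]; rewrite in_itv/= => /andP[yq qx].
by move: qx; rewrite -xy ltNge (ltW yq).
Qed.

(* Characteristic sequence of the pair of Dedekind cuts of [x] and [y], indexed
   by the codes of the elements of [bool * rat]. *)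
Definition cuts (R : realType) (x y : R) (n : nat) : bool :=
  if unpickle n is Some (e, q) then ratr (q : rat) < if e : bool then x else y
  else false.

Lemma cuts_inj (R : realType) (x y u v : R) :
  cuts R x y =1 cuts R u v -> x = u /\ y = v.
Proof.
move=> E; split; apply: eq_rat_cut => q.
  by have := E (pickle (true, q)); rewrite /cuts pickleK.
by have := E (pickle (false, q)); rewrite /cuts pickleK.
Qed.

(** Sorting the two reals first makes the code depend only on the unordered pair. *)
Definition pair_code (R : realType) (x y : R) : R :=
  ternary_sum R (cuts R (Num.min x y) (Num.max x y)).

Lemma pair_codeC (R : realType) (x y : R) : pair_code R x y = pair_code R y x.
Proof. by rewrite /pair_code minC maxC. Qed.

Lemma pair_code_inj (R : realType) (x y u v : R) :
  pair_code R x y = pair_code R u v -> (x = u /\ y = v) \/ (x = v /\ y = u).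
Proof.
move=> /ternary_sum_inj/cuts_inj[].
by rewrite /Num.min /Num.max; case: ifP; case: ifP => _ _ -> ->; auto.
Qed.

(** * The pseudometric given by a labelling with reals *)

Definition rigid_dist (R : realType) (X : Type) (h : X -> R) (p : X * X) : R :=
  if h p.1 == h p.2 then 0 else 2 + pair_code R (h p.1) (h p.2).

Lemma rigid_dist_eq0 (R : realType) (X : Type) (h : X -> R) x y :
  rigid_dist R X h (x, y) = 0 <-> h x = h y.
Proof.
rewrite /rigid_dist /=; case: eqP => // ne; split => // E.
have := ternary_sum_itv R (cuts R (Num.min (h x) (h y)) (Num.max (h x) (h y))).
by rewrite -/(pair_code _ _ _); lra.
Qed.

Lemma rigid_dist_srp (R : realType) (X : Type) (h : X -> R) :
  strongly_rigid_pseudometric (rigid_dist R X h).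
Proof.
have code_itv x y : 0 <= pair_code R x y <= 3 / 2 by apply: ternary_sum_itv.
split; first (split => [x y|x y|x|x y z]; rewrite /rigid_dist/=).
- by case: ifP => // _; have := code_itv (h x) (h y); lra.
- by rewrite eq_sym pair_codeC.
- by rewrite eqxx.
- have := (code_itv (h x) (h y), code_itv (h y) (h z), code_itv (h x) (h z)).
  move=> [[]].
  have [->|xy] := eqVneq (h x) (h y); first by case: ifP => _; lra.
  have [<-|yz] := eqVneq (h y) (h z); first by rewrite (negPf xy); lra.
  (* The left side is at most 7/2, while both distances on the right are at least 2. *)
  by case: ifP => _; lra.
move=> x y u v E uv0.
have huv : h u <> h v by move/rigid_dist_eq0.
have hxy : h x <> h y by rewrite -(rigid_dist_eq0 R X h) E.
move: E; rewrite /rigid_dist/=; case: eqP => // _; case: eqP => // _.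
(* Equal codes give equal unordered pairs of labels; the two ways to match them are the two cases of
   strong rigidity. *)
move=> /addrI/pair_code_inj[[-> ->]|[-> ->]]; [left|right]; by rewrite !eqxx.
Qed.

(** * Partitions into fibers *)

Lemma fiber_partition_eqP (T Z W : Type) (F : T -> Z) (G : T -> W) :
  fiber_partition F = fiber_partition G <-> forall p q, F p = F q <-> G p = G q.
Proof.
have half (Z' W' : Type) (F' : T -> Z') (G' : T -> W') :
      fiber_partition F' = fiber_partition G' ->
    forall p q, F' p = F' q -> G' p = G' q.
  (* The fiber of [F'] through [p] is also the fiber of [G'] over some [w], so [G'] is constant on
     it. *)
  move=> E p q Fpq; have : fiber_partition F' (F' @^-1` [set F' p]).
    by exists (F' p) => //; exists p.
  rewrite E => -[w _ Ew].
  have Gw r : F' r = F' p -> G' r = w.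
    by move=> Fr; have : (F' @^-1` [set F' p]) r by []; rewrite -Ew.
  by rewrite !Gw.
split=> [E p q|E]; first by split; apply: half.
have sub (Z' W' : Type) (F' : T -> Z') (G' : T -> W') :
    (forall p q, F' p = F' q <-> G' p = G' q) ->
    fiber_partition F' `<=` fiber_partition G'.
  move=> FG _ [_ [p _ <-] <-]; exists (G' p); first by exists p.
  by apply/seteqP; split=> q /= /FG.
by apply/seteqP; split; apply: sub => p q; rewrite E.
Qed.

(** The diagonal block is the fiber over 0. On any other block [d] is constant by the triangle
    inequality, and strong rigidity keeps distinct blocks from sharing a value. Taking [P] and [d]
    as given, linked by [dP], serves both directions: [P] built from [d] and [d] built from [P]. *)
Lemma tensor_PS1_fibers (R : realType) (X : Type) (d : X * X -> R)
    (P : set (set X)) :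
    [set: X] !=set0 -> strongly_rigid_pseudometric d ->
    partition P id [set: X] ->
    (forall x y, d (x, y) = 0 <-> exists2 A, P A & A x /\ A y) ->
  tensor_PS1 P = fiber_partition d.
Proof.
move=> [x0 _] [[_ dC d0 dT] rigid] [Pcov Ptriv Pne] dP.
have blockP x : exists2 A, P A & A x.
  by have : [set: X] x by []; rewrite -Pcov.
have block_uniq A B x : P A -> P B -> A x -> B x -> A = B.
  by move=> PA PB Ax Bx; apply: Ptriv => //; exists x.
have same A x y : P A -> A x -> d (x, y) = 0 <-> A y.
  move=> PA Ax; rewrite dP; split=> [[B PB [Bx By]]|Ay]; last by exists A.
  by rewrite (block_uniq A B x).
have diag : \bigcup_(A in P) (A `*` A) = d @^-1` [set 0].
  apply/seteqP; split=> -[x y].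
    by move=> [A PA [/= Ax Ay]]; apply/dP; exists A.
  by move=> /= /dP[A PA [Ax Ay]]; exists A.
have offdiag A B x y : P A -> P B -> A <> B -> A x -> B y ->
    (A `*` B) `|` (B `*` A) = d @^-1` [set d (x, y)].
  move=> PA PB AB Ax By.
  have dxy : d (x, y) <> 0.
    by move/(same A x y PA Ax) => Ay; apply/AB/(block_uniq A B y).
  (* Moving both endpoints by distance 0 changes [d] in neither direction. *)
  have far x' y' : d (x, x') = 0 -> d (y, y') = 0 -> d (x', y') = d (x, y).
    move=> xx yy; have xx' : d (x', x) = 0 by rewrite dC.
    have yy' : d (y', y) = 0 by rewrite dC.
    have := (dT x x' y, dT x' y' y, dT x' x y', dT x y y').
    by move=> [[[]]]; lra.
  apply/seteqP; split=> -[u v] /=.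
    move=> [[/= /(same A x u PA Ax) xu /(same B y v PB By) yv]|
            [/= /(same B y u PB By) yu /(same A x v PA Ax) xv]]; first exact: far.
    by rewrite dC; apply: far.
  move=> E; case: (rigid x y u v (esym E)) => [|[xu yv]|[xv yu]].
  - by rewrite E.
  - by left; split=> /=; [apply/(same A x u PA Ax)|apply/(same B y v PB By)].
  - by right; split=> /=; [apply/(same B y u PB By)|apply/(same A x v PA Ax)].
apply/seteqP; split=> C.
  move=> [->|[A [B [PA PB AB ->]]]].
    by rewrite diag; exists 0 => //; exists (x0, x0).
  have [[x Ax] [y By]] := (Pne A PA, Pne B PB).
  by rewrite (offdiag A B x y)//; exists (d (x, y)) => //; exists (x, y).
move=> [_ [[x y] _ <-] <-].
have [[A PA Ax] [B PB By]] := (blockP x, blockP y).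
have [AB|AB] := pselect (A = B).
  left; rewrite diag; congr (d @^-1` [set _]).
  by apply/(same A x y PA Ax); rewrite AB.
by right; exists A, B; split=> //; rewrite (offdiag A B x y).
Qed.

(** * Cardinality and combinatorial similarity *)

Lemma card_le_realP (R : realType) (T : Type) (A : set T) :
  A #<= [set: R] <-> exists f : T -> R, {in A &, injective f}.
Proof.
pose pR : pointedType := HB.pack (Real.sort R) (isPointed.Build R 0).
by split=> /(@pcard_injP T pR).
Qed.

(** [f \o Phi] is [d] transported along the inverse of [g], so it inherits the axioms; since [f] is
    injective on the values of [Phi], the fibers stay the same. *)
Lemma similar_srp_pullback (R : realType) (X Y Z : Type) (Phi : X * X -> Z)
    (d : Y * Y -> R) :
    strongly_rigid_pseudometric d -> combinatorially_similar Phi d ->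
  exists d' : X * X -> R,
    strongly_rigid_pseudometric d' /\ fiber_partition Phi = fiber_partition d'.
Proof.
move=> [[dge0 dC d0 dT] rigid] [f [g [[_ finj _] [g' _ g'K] dE]]].
have fE x y : f (Phi (x, y)) = d (g' x, g' y) by rewrite dE !g'K.
exists (f \o Phi); split.
  split; first by split=> *; rewrite /= !fE.
  by move=> x y u v /=; rewrite !fE => /rigid.
apply/fiber_partition_eqP => p q; split=> [/= -> //|].
by apply: finj; rewrite inE; [exists p|exists q].
Qed.

Lemma fibers_similar (R : realType) (X Z : Type) (Phi : X * X -> Z)
    (d : X * X -> R) :
    fiber_partition Phi = fiber_partition d -> combinatorially_similar Phi d.
Proof.
move=> /fiber_partition_eqP E.
have [f fE] : exists f : Z -> R, forall p, f (Phi p) = d p.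
  have /choice[f fP] z : exists r, forall p, Phi p = z -> d p = r.
    have [[q <-]|nz] := pselect (exists q, Phi q = z).
      by exists (d q) => p /E.
    (* Here [z] is not a value of [Phi], and 0 is an arbitrary default. *)
    by exists 0 => p pz; case: nz; exists p.
  by exists f => p; rewrite -(fP _ p erefl).
exists f, id; split; [split | by exists id | by move=> x y; rewrite fE].
- by move=> _ [p _ <-]; rewrite fE; exists p.
- by move=> _ _ /set_mem[p _ <-] /set_mem[q _ <-]; rewrite !fE => /E.
- by move=> _ [p _ <-]; exists (Phi p); [exists p | rewrite fE].
Qed.

(** * From a pseudometric to a partition and back *)

Lemma srp_partition (R : realType) (X : Type) (d : X * X -> R) :
    [set: X] !=set0 -> strongly_rigid_pseudometric d ->
  exists P : set (set X),
    [/\ partition P id [set: X], tensor_PS1 P = fiber_partition d &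
        P #<= [set: R]].
Proof.
move=> X0 srp; have [[dge0 dC d0 dT] rigid] := srp.
pose cls x : set X := [set y | d (x, y) = 0].
have d0T x y z : d (x, y) = 0 -> d (y, z) = 0 -> d (x, z) = 0.
  by move=> xy yz; have := (dge0 x z, dT x y z); rewrite xy yz => -[]; lra.
have cls_eq x y : d (x, y) = 0 -> cls x = cls y.
  move=> xy; apply/seteqP; split=> z /=; last exact: d0T.
  by apply: d0T; rewrite dC.
have part : partition (range cls) id [set: X].
  split.
  - by apply/seteqP; split=> // x _; exists (cls x); [exists x | apply: d0].
  - move=> _ _ [x _ <-] [y _ <-] [z [/= xz yz]]; apply: cls_eq.
    by apply: (d0T x z) => //; rewrite dC.
  - by move=> _ [x _ <-]; exists x; apply: d0.
exists (range cls); split=> //.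
  apply: tensor_PS1_fibers => // x y; split=> [xy|[_ [z _ <-] [/= zx zy]]].
    by exists (cls x); [exists x | split=> //; apply: d0].
  by apply: (d0T x z) => //; rewrite dC.
have [x0 _] := X0.
have rep A : range cls A -> exists x, A = cls x by move=> [x _ <-]; exists x.
have /choice[r rP] A : exists x, range cls A -> A = cls x.
  have [/rep[x ->]|nA] := pselect (range cls A); first by exists x.
  by exists x0.
(* A class is labelled by its distance from [x0]. A common label 0 puts both representatives in the
   class of [x0]; for a common nonzero label, strong rigidity with shared endpoint [x0] puts them at
   distance 0. *)
apply/card_le_realP; exists (fun A => d (x0, r A)) => A B /set_mem PA /set_mem PB E.
rewrite (rP A PA) (rP B PB); apply: cls_eq.
have [B0|B0] := eqVneq (d (x0, r B)) 0.
  by apply: (d0T _ x0); rewrite // dC E.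
case: (rigid _ _ _ _ E); first exact/eqP.
  by case.
by move=> [E0 _]; move: B0; rewrite E0 eqxx.
Qed.

Lemma partition_srp (R : realType) (X : Type) (P : set (set X)) :
    [set: X] !=set0 -> partition P id [set: X] -> P #<= [set: R] ->
  exists2 d : X * X -> R,
    strongly_rigid_pseudometric d & tensor_PS1 P = fiber_partition d.
Proof.
move=> X0 part /card_le_realP[f finj].
have [Pcov Ptriv _] := part.
have /choice[b bP] x : exists A, P A /\ A x.
  by have : [set: X] x by []; rewrite -Pcov => -[A PA Ax]; exists A.
(* [b] picks the block of a point and [f] labels blocks injectively, so equal labels mean a common
   block. *)
exists (rigid_dist R X (f \o b)); first exact: rigid_dist_srp.
apply: tensor_PS1_fibers => //; first exact: rigid_dist_srp.
move=> x y; rewrite rigid_dist_eq0 /=.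
have [[Px bx] [Py yb]] := (bP x, bP y); split=> [/finj E|[A PA [Ax Ay]]].
  by exists (b x) => //; split=> //; rewrite E// inE.
congr f; rewrite (Ptriv (b x) A)//; last by exists x.
by apply: Ptriv => //; exists y.
Qed.

Theorem theorem4p13 (R : realType) (X Z : Type) (Phi : X * X -> Z)
    (X_nonempty : [set: X] !=set0) :
  ((exists d : X * X -> R,
      strongly_rigid_pseudometric d /\
      fiber_partition Phi = fiber_partition d)
   <->
   (exists (Y : Type) (d : Y * Y -> R),
      strongly_rigid_pseudometric d /\ combinatorially_similar Phi d))
  /\
  ((exists (Y : Type) (d : Y * Y -> R),
      strongly_rigid_pseudometric d /\ combinatorially_similar Phi d)
   <->
   (exists P : set (set X),
      [/\ partition P id [set: X],
          tensor_PS1 P = fiber_partition Phi &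
          P #<= [set: R]])).
Proof.
split; split.
- by move=> [d [srp /fibers_similar sim]]; exists X, d.
- by move=> [Y [d [srp /(similar_srp_pullback _ _ _ _ _ _ srp)]]].
- move=> [Y [d [srp /(similar_srp_pullback _ _ _ _ _ _ srp)[d' [srp' ->]]]]].
  exact: srp_partition.
- move=> [P [part E /(partition_srp _ _ _ X_nonempty part)[d srp Ed]]].
  by exists X, d; split=> //; apply: fibers_similar; rewrite -E.
Qed.
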